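(* Consider the freeway model $x^+=\tilde F(d,x,u)$, $x\in S$, $d\in D=[0,1]^{n-1}$, $u\in(0,+\infty)\times\mathbb{R}_+^{n-1}$, with $n\ge 3$ (defined in the context), and assume that each demand function $f_i$ ($i=1,\dots,n$) satisfies assumption (H) of the context, with constants $\delta_i,\tilde\delta_i,L_i$. Let $u_1^*>0$, $u_i^*\ge 0$ ($i=2,\dots,n$) and $x^*=(x_1^*,\dots,x_n^* )\in(0,\tilde\delta_1)\times\dots\times(0,\tilde\delta_n)$ satisfy $$f_1(x_1^* )=u_1^*,\qquad f_i(x_i^* )=u_i^*+(1-p_{i-1})f_{i-1}(x_{i-1}^* )\quad (i=2,\dots,n),$$ $$u_1^*<\min\big(q_1,c_1(a_1-x_1^* )\big),\qquad u_i^*+(1-p_{i-1})f_{i-1}(x_{i-1}^* )<\min\big(q_i,c_i(a_i-x_i^* )\big)\quad (i=2,\dots,n).$$ Then there exist a subset $R\subseteq\{1,\dots,n\}$ of the set of all indices $i\in\{1,\dots,n\}$ with $u_i^*>0$, constants $\sigma\in(0,1]$, $b_i\in(0,u_i^* )$ for $i\in R$, and a constant $\tau^*>0$ such that for every $\tau\in(0,\tau^* )$ the feedback law $k:S\to\mathbb{R}_+^n$, $k(x)=(k_1(x),\dots,k_n(x))'$, defined by $$k_i(x):=\max\big(u_i^*-\gamma_i\,\Xi(x),\,b_i\big)\ \text{ for } x\in S,\ i\in R,\qquad k_i(x):=u_i^*\ \text{ for } x\in S,\ i\notin R,$$ where $\gamma_i:=\tau^{-1}(u_i^*-b_i)$ and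 $\Xi(x):=\sum_{i=1}^n\sigma^i\max(0,x_i-x_i^* )$ for $x\in S$, achieves robust global exponential stabilization of $x^*$, i.e. $x^*$ is Robustly Globally Exponentially Stable (RGES) for the closed-loop system $x^+=\tilde F(d,x,k(x))$, $x\in S$, $d\in D$. Moreover, for every $\tau\in(0,\tau^* )$ there exist constants $Q,h,\theta,A,K>0$ such that the function $V:S\to\mathbb{R}_+$ defined by $$V(x):=\sum_{i=1}^n\sigma^i|x_i-x_i^*|+A\,\Xi(x)+K\max\Big(0,\ \sum_{i=1}^n I_i(x)-P(x)\Big),\qquad x\in S,$$ where $I_j(x):=\sum_{i=1}^j x_i$ for $j=1,\dots,n$ and $P(x):=Q-\theta\min\big(h,\Xi(x)\big)$, is a Lyapunov function with exponent $1$ for the closed-loop system $x^+=\tilde F(d,x,k(x))$.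
   Context: Notation: $\mathbb{R}_+=[0,+\infty)$; $|\cdot|$ is the Euclidean norm (absolute value for scalars); $'$ on a vector denotes transpose. Model data: an integer $n\ge 3$; constants $a_i>0$, $q_i\in(0,+\infty)$, $c_i\in(0,1]$ for $i=1,\dots,n$; constants $p_i\in[0,1)$ for $i=1,\dots,n-1$ and $p_n=1$; functions $f_i:[0,a_i]\to\mathbb{R}_+$ for $i=1,\dots,n$. State space $S=(0,a_1]\times\dots\times(0,a_n]$; disturbance set $D=[0,1]^{n-1}$ with elements $d=(d_2,\dots,d_n)$; inputs $u=(u_1,\dots,u_n)'\in(0,+\infty)\times\mathbb{R}_+^{n-1}$. The map $\tilde F:D\times S\times\big((0,+\infty)\times\mathbb{R}_+^{n-1}\big)\to S$ has components $$\tilde F_1(d,x,u)=x_1-s_2f_1(x_1)+\min\big(q_1,c_1(a_1-x_1),u_1\big),$$ $$\tilde F_i(d,x,u)=x_i-s_{i+1}f_i(x_i)+\min\big(q_i,c_i(a_i-x_i),u_i+(1-p_{i-1})f_{i-1}(x_{i-1})\big),\quad i=2,\dots,n-1,$$ $$\tilde F_n(d,x,u)=x_n-f_n(x_n)+\min\big(q_n,c_n(a_n-x_n),u_n+(1-p_{n-1})f_{n-1}(x_{n-1})\big),$$ where, for $i=2,\dots,n$, $$s_i=(1-d_i)\min\Big(1,\max\Big(0,\tfrac{\min(q_i,c_i(a_i-x_i))-u_i}{(1-p_{i-1})f_{i-1}(x_{i-1})}\Big)\Big)+d_i\min\Big(1,\tfrac{\min(q_i,c_i(a_i-x_i))}{(1-p_{i-1})f_{i-1}(x_{i-1})}\Big).$$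 Assumption (H) (for each $i=1,\dots,n$): $f_i\in C^0([0,a_i];\mathbb{R}_+)$ satisfies $0<f_i(z)<z$ for all $z\in(0,a_i]$. There exists $\delta_i\in(0,a_i]$ such that $f_i$ is (strictly) increasing on $[0,\delta_i]$ and non-increasing on $[\delta_i,a_i]$. Moreover, there exist constants $L_i\in(0,1)$, $\tilde\delta_i\in(0,\delta_i]$ such that $f_i$ is $C^1$ on $(0,\delta_i)$, $1-L_i\le f_i'(z)$ for all $z\in(0,\tilde\delta_i)$, and $f_i'(z)\le 1$ for all $z\in(0,\delta_i)$. Stability notions. Let $F:D\times S\to S$ and let $x^*\in S$ satisfy $F(d,x^* )=x^*$ for all $d\in D$. - $x^*$ is RGES for $x^+=F(d,x)$ if there exist constants $M,\bar\sigma>0$ such that for every $x_0\in S$ and every sequence $\{d(t)\in D\}_{t=0}^\infty$, the solution of $x(t+1)=F(d(t),x(t))$, $x(0)=x_0$, satisfies $|x(t)-x^*|\le M\exp(-\bar\sigma t)|x_0-x^*|$ for all integers $t\ge 0$. - A function $V:S\to\mathbb{R}_+$ is a Lyapunov function with exponent $p>0$ for $x^+=F(d,x)$ if there exist constants $K_2\ge K_1>0$ and $\lambda\in[0,1)$ such that $K_1|x-x^*|^p\le V(x)\le K_2|x-x^*|^p$ and $V(F(d,x))\le\lambda V(x)$ for all $(d,x)\in D\times S$. *)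

(* Defs.v *)
From HB Require Import structures.
From mathcomp Require Import all_boot all_order all_algebra.
From mathcomp Require Import all_classical all_reals all_analysis.
Set Implicit Arguments.
Unset Strict Implicit.
Unset Printing Implicit Defensive.
Import Order.TTheory GRing.Theory Num.Theory.
Import numFieldNormedType.Exports.
Local Open Scope classical_set_scope.
Local Open Scope ring_scope.

(* MathComp's norm on row vectors is the sup norm, hence this definition. *)
Definition euclid_norm (R : realType) (n : nat) (v : 'rV[R]_n) : R :=
  Num.sqrt (\sum_(i < n) v 0 i ^+ 2).

Section Stability.
Context (R : realType) (n m : nat).
Variables (S : set 'rV[R]_n) (D : set 'rV[R]_m).
Variables (F : 'rV[R]_m -> 'rV[R]_n -> 'rV[R]_n) (xs : 'rV[R]_n).

(* The standing setting of the stability notions: F restricts to a map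
   D * S -> S, and xs in S is a fixed point of F d for every d in D. *)
Definition robust_equilibrium : Prop :=
  [/\ forall d x, D d -> S x -> S (F d x),
      S xs
    & forall d, D d -> F d xs = xs].

Definition RGES : Prop :=
  robust_equilibrium /\
  exists M sbar : R, [/\ 0 < M, 0 < sbar &
    forall (x : nat -> 'rV[R]_n) (d : nat -> 'rV[R]_m),
      S (x 0%N) -> (forall t, D (d t)) ->
      (forall t, x t.+1 = F (d t) (x t)) ->
      forall t : nat, euclid_norm (x t - xs)
        <= M * expR (- sbar * t%:R) * euclid_norm (x 0%N - xs)].

Definition lyapunov_with_exponent (p : R) (V : 'rV[R]_n -> R) : Prop :=
  [/\ robust_equilibrium, 0 < p, forall x, S x -> 0 <= V x &
  exists K1 K2 lambda : R,
    [/\ 0 < K1, K1 <= K2, 0 <= lambda < 1,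
        forall x, S x -> K1 * euclid_norm (x - xs) `^ p <= V x
                         <= K2 * euclid_norm (x - xs) `^ p
      & forall d x, D d -> S x -> V (F d x) <= lambda * V x]].

End Stability.

(* Cells are numbered from 0: cell i here is cell i + 1 of the model.  The
   demand functions live on R; only their values on [0, a i] matter. *)
Record freeway (R : realType) (n : nat) := Freeway {
  capacity : 'I_n -> R;            (* a_i *)
  max_inflow : 'I_n -> R;          (* q_i *)
  congestion : 'I_n -> R;          (* c_i *)
  exit_rate : 'I_n -> R;           (* p_i *)
  demand : 'I_n -> R -> R;         (* f_i *)
  capacity_gt0 : forall i, 0 < capacity i;
  max_inflow_gt0 : forall i, 0 < max_inflow i;
  congestion_itv : forall i, 0 < congestion i <= 1;
  exit_rate_itv : forall i : 'I_n, (i.+1 < n)%N -> 0 <= exit_rate i < 1;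
  exit_rate_last : forall i : 'I_n, i.+1 = n -> exit_rate i = 1;
  demand_ge0 : forall i z, 0 <= z <= capacity i -> 0 <= demand i z
}.

Section FreewayMap.
Context (R : realType) (n : nat).
Variable (fw : freeway R n).

Local Notation a := (capacity fw).
Local Notation q := (max_inflow fw).
Local Notation c := (congestion fw).
Local Notation p := (exit_rate fw).
Local Notation f := (demand fw).

Definition state_space : set 'rV[R]_n :=
  [set x | forall i, 0 < x 0 i <= a i].

Definition disturbance_set : set 'rV[R]_n.-1 :=
  [set d | forall j, 0 <= d 0 j <= 1].

Definition input_set : set 'rV[R]_n :=
  [set u | forall i : 'I_n, if i == 0 :> nat then 0 < u 0 i else 0 <= u 0 i].

(* The disturbance acting at the entrance of cell i > 0; the default value is
   never used for such i, because then i.-1 < n.-1. *)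
Definition disturbance_at (d : 'rV[R]_n.-1) (i : 'I_n) : R :=
  if insub i.-1 is Some j then d 0 j else 0.

Definition supply (x : 'rV[R]_n) (i : 'I_n) : R :=
  Num.min (q i) (c i * (a i - x 0 i)).

(* (1 - p_(i-1)) f_(i-1)(x_(i-1)); ord_pred and ordS are cyclic, and are only
   used away from the wrap-around. *)
Definition upstream_demand (x : 'rV[R]_n) (i : 'I_n) : R :=
  (1 - p (ord_pred i)) * f (ord_pred i) (x 0 (ord_pred i)).

Definition total_demand (x u : 'rV[R]_n) (i : 'I_n) : R :=
  if i == 0 :> nat then u 0 i else u 0 i + upstream_demand x i.

(* s_i, for i > 0. *)
Definition outflow_share (d : 'rV[R]_n.-1) (x u : 'rV[R]_n) (i : 'I_n) : R :=
  (1 - disturbance_at d i) *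
    Num.min 1 (Num.max 0 ((supply x i - u 0 i) / upstream_demand x i))
  + disturbance_at d i * Num.min 1 (supply x i / upstream_demand x i).

Definition freeway_map (d : 'rV[R]_n.-1) (x u : 'rV[R]_n) : 'rV[R]_n :=
  \row_(i < n)
    (x 0 i
     - (if (i.+1 < n)%N then outflow_share d x u (ordS i) else 1)
         * f i (x 0 i)
     + Num.min (q i)
         (Num.min (c i * (a i - x 0 i)) (total_demand x u i))).

End FreewayMap.

Definition assumption_H (R : realType) (a : R) (f : R -> R)
    (delta tdelta L : R) : Prop :=
  [/\ {within `[0, a], continuous f},
      forall z, 0 < z <= a -> 0 < f z < z,
      0 < delta <= a,
      {in `[0, delta] &, {homo f : y z / y < z}}
    & {in `[delta, a] &, {homo f : y z /~ y <= z}}] /\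
  [/\ 0 < L < 1,
      0 < tdelta <= delta,
      forall z, 0 < z < delta ->
        derivable f z 1 /\ {for z, continuous (f^`())%classic},
      forall z, 0 < z < tdelta -> 1 - L <= (f^`())%classic z
    & forall z, 0 < z < delta -> (f^`())%classic z <= 1].

Section Feedback.
Context (R : realType) (n : nat).
Variables (sigma : R) (xs : 'rV[R]_n).

(* The exponents are i + 1 because cells are numbered from 0. *)
Definition Xi (x : 'rV[R]_n) : R :=
  \sum_(i < n) sigma ^+ i.+1 * Num.max 0 (x 0 i - xs 0 i).

Definition feedback (us : 'rV[R]_n) (J : {set 'I_n}) (b : 'I_n -> R) (tau : R)
    (x : 'rV[R]_n) : 'rV[R]_n :=
  \row_(i < n)
    if i \in J then
      let gamma := tau^-1 * (us 0 i - b i) in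
      Num.max (us 0 i - gamma * Xi x) (b i)
    else us 0 i.

Definition partial_sum (x : 'rV[R]_n) (j : 'I_n) : R :=
  \sum_(i < n | (i <= j)%N) x 0 i.

Definition lyapunov_candidate (Q h theta A K : R) (x : 'rV[R]_n) : R :=
  let P := Q - theta * Num.min h (Xi x) in
  \sum_(i < n) sigma ^+ i.+1 * `|x 0 i - xs 0 i| + A * Xi x
  + K * Num.max 0 (\sum_(j < n) partial_sum x j - P).

End Feedback.

(* Main.v *)
Require Import Defs.
From mathcomp Require Import all_boot all_order all_algebra.
From mathcomp Require Import all_classical all_reals all_analysis.
From mathcomp Require Import ring lra.
Import Order.TTheory GRing.Theory Num.Theory.
Import numFieldNormedType.Exports.

(* With J = {i | us_i > 0}, three regimes of Xi are treated separately.
   For Xi < h every cell is in free flow, and both sum_i sigma^i |x_i - xs_i|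
   and Xi contract, up to the perturbation us - k(x), which is O(Xi) and is
   absorbed by the term A Xi.  For Xi >= tau the feedback is saturated at b, so
   the total input is small, while some cell is above equilibrium and the total
   outflow is at least a constant: the weighted mass W = sum_j I_j decreases by
   a fixed amount r.  When Xi >= h one has P = 0, and K is chosen so large that
   K r dominates the whole bounded remainder of V.  When Xi < tau the excess
   W - P is nonpositive at the next step, because Q > W(xs) and tau is small. *)

Set Implicit Arguments.
Unset Strict Implicit.
Unset Printing Implicit Defensive.
Local Open Scope ring_scope.

(** * Preliminaries: finite minima, norm comparisons, and exponential stability from a Lyapunov
    function *)

Lemma finite_lower_bound (R : realType) (I : finType) (g : I -> R) :
  (forall i, 0 < g i) -> exists2 e, 0 < e & forall i, e <= g i.
Proof.
move=> g0; exists (\big[Num.min/1]_i g i).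
  by elim/big_rec: _ => // i x _ x0; rewrite lt_min g0.
by move=> i; rewrite (bigD1 i)//= ge_min lexx.
Qed.

Section EuclideanNorm.
Context (R : realType) (n : nat).
Implicit Type v : 'rV[R]_n.

Lemma euclid_norm_ge0 v : 0 <= euclid_norm v.
Proof. exact: sqrtr_ge0. Qed.

Lemma normr_le_euclid_norm v i : `|v 0 i| <= euclid_norm v.
Proof.
rewrite -sqrtr_sqr ler_sqrt ?sumr_ge0// => [|j _]; last exact: sqr_ge0.
by rewrite (bigD1 i)//= lerDl sumr_ge0// => j _; exact: sqr_ge0.
Qed.

Lemma euclid_norm_le_sum v : euclid_norm v <= \sum_i `|v 0 i|.
Proof.
have s0 : 0 <= \sum_i `|v 0 i| by exact: sumr_ge0.
rewrite -[leRHS]ger0_norm// -sqrtr_sqr ler_sqrt ?sqr_ge0//.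
rewrite expr2 mulr_suml ler_sum// => i _.
rewrite -real_normK ?num_real// expr2 ler_wpM2l// (bigD1 i)//= lerDl.
exact: sumr_ge0.
Qed.

Lemma sum_norm_le_euclid_norm v : \sum_i `|v 0 i| <= n%:R * euclid_norm v.
Proof.
rewrite mulr_natl -[X in _ *+ X]card_ord -sumr_const ler_sum// => i _.
exact: normr_le_euclid_norm.
Qed.

End EuclideanNorm.

(** Iterating the decrease gives a geometric bound on [V]; the two-sided estimate turns it into a
    bound on the norm with gain [K2 / K1]. *)
Lemma lyapunov_RGES (R : realType) (n m : nat) (S : set 'rV[R]_n)
    (D : set 'rV[R]_m) F xs V :
  lyapunov_with_exponent S D F xs 1 V -> RGES S D F xs.
Proof.
move=> [re _ V0 [K1 [K2 [l0 [K10 K12 /andP[l00 l01] Vb Vd]]]]].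
split=> //.
(* The factor [l0] may be 0, and then [- ln l0] is not a positive rate; the floor 1/2 keeps [l]
   strictly between 0 and 1. *)
pose l := Num.max l0 2^-1.
have l_gt0 : 0 < l by rewrite lt_max invr_gt0 ltr0n orbT.
have l_lt1 : l < 1 by rewrite gt_max l01 invf_lt1 ?ltr0n// ltr1n.
have l0l : l0 <= l by rewrite le_max lexx.
exists (K2 / K1), (- ln l); split.
- by rewrite divr_gt0// (lt_le_trans K10).
- by rewrite oppr_gt0 ln_lt0// l_gt0.
move=> x d Sx0 Dd xS t.
have xSt s : S (x s).
  by elim: s => // s IH; rewrite xS; case: re => + _ _; apply.
have Vt s : V (x s) <= l ^+ s * V (x 0%N).
  elim: s => [|s IH]; first by rewrite expr0 mul1r.
  rewrite xS (le_trans (Vd _ _ (Dd s) (xSt s)))// exprS -mulrA.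
  by rewrite (le_trans (ler_wpM2r (V0 _ (xSt s)) l0l))// ler_wpM2l// ltW.
have -> : expR (- - ln l * t%:R) = l ^+ t.
  by rewrite opprK mulrC expRM_natl lnK.
have /andP[Vl _] := Vb _ (xSt t).
have /andP[_ Vu] := Vb _ Sx0.
move: Vl Vu; rewrite !powRr1 ?euclid_norm_ge0// => Vl Vu.
rewrite -(ler_pM2l K10) (le_trans Vl)// (le_trans (Vt t))//.
have -> : K1 * (K2 / K1 * l ^+ t * euclid_norm (x 0 - xs))
    = l ^+ t * (K2 * euclid_norm (x 0 - xs)) by field; rewrite gt_eqF.
by rewrite ler_wpM2l// exprn_ge0// ltW.
Qed.

Lemma convex_comb_ge (R : realType) (d l x y : R) : 0 <= d <= 1 ->
  l <= x -> l <= y -> l <= (1 - d) * x + d * y.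
Proof. by move=> /andP[d0 d1] lx ly; nra. Qed.

Lemma convex_comb_le (R : realType) (d l x y : R) : 0 <= d <= 1 ->
  x <= l -> y <= l -> (1 - d) * x + d * y <= l.
Proof. by move=> /andP[d0 d1] lx ly; nra. Qed.

(* The share [s_i], with [m] the supply, [v] the external inflow and [U] the
   upstream demand. *)
Section Share.
Context (R : realType) (d m v U : R).
Hypotheses (d01 : 0 <= d <= 1) (m0 : 0 <= m) (v0 : 0 <= v) (U0 : 0 < U).
Let s := (1 - d) * Num.min 1 (Num.max 0 ((m - v) / U)) + d * Num.min 1 (m / U).

Lemma share_itv : 0 <= s <= 1.
Proof.
apply/andP; split.
  apply: convex_comb_ge => //; rewrite le_min ler01 ?le_max ?lexx//.
  by rewrite divr_ge0// ltW.
by apply: convex_comb_le => //; rewrite ge_min lexx.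
Qed.

(** Divided by [U], the left-hand side is at most 1 and at most [(m - v) / U], hence below both
    extreme shares ([v0] settles the second) and below any convex combination of them. The bound is
    therefore uniform in the disturbance. *)
Lemma share_ge : Num.min m (v + U) - v <= s * U.
Proof.
set t := Num.min m (v + U) - v.
have Ut : t / U <= Num.min 1 ((m - v) / U).
  rewrite le_min ler_pdivrMr// mul1r ler_pM2r ?invr_gt0// /t.
  by rewrite lerBlDl ge_min lexx orbT/= lerD2r ge_min lexx.
rewrite -ler_pdivrMr//.
apply: convex_comb_ge => //; apply: (le_trans Ut); rewrite le_min ge_min lexx/=.
  by rewrite ge_min; apply/orP; right; rewrite le_max lexx orbT.
by rewrite ge_min ler_pM2r ?invr_gt0// gerBl v0 orbT.
Qed.

Lemma share_eq1 : v + U <= m -> s = 1.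
Proof.
move=> h; apply/eqP; rewrite eq_le; case/andP: share_itv => _ ->/=.
have := share_ge; rewrite min_r// => h1.
by rewrite -(ler_pM2r U0) mul1r (le_trans _ h1)// addrAC subrr add0r.
Qed.

End Share.

(** * Sums over neighbouring cells *)

Lemma sum_ordS (V : nmodType) (n : nat) (F : 'I_n -> 'I_n -> V) :
  \sum_(i < n) (if i == 0 :> nat then 0 else F i (ord_pred i)) =
  \sum_(j < n) (if (j.+1 < n)%N then F (ordS j) j else 0).
Proof.
(* The cyclic successor sends only the last cell to index 0, so the wrap-around term vanishes on
   both sides. *)
rewrite (reindex_inj (@ordS_inj n)); apply: eq_bigr => j _.
rewrite ordSK /=; case: ltnP => h; first by rewrite modn_small.
have -> : j.+1 = n by apply/eqP; rewrite eqn_leq h ltn_ord.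
by rewrite modnn.
Qed.

(** A contribution from the preceding cell is weighted by one more power of [sigma] than that cell
    itself, so the whole coupling costs only [sigma] in the contraction factor. This is the purpose
    of the geometric weights. *)
Lemma weighted_sum_shift (R : realType) (n : nat) (sigma l : R)
    (g g' v : 'I_n -> R) :
  0 <= sigma -> (forall i, 0 <= g i) ->
  (forall i, g' i <= l * g i + v i
                     + (if i == 0 :> nat then 0 else g (ord_pred i))) ->
  \sum_(i < n) sigma ^+ i.+1 * g' i <=
    (l + sigma) * (\sum_(i < n) sigma ^+ i.+1 * g i) + \sum_(i < n) sigma ^+ i.+1 * v i.
Proof.
move=> s0 g0 gg'.
apply: (@le_trans _ _ (\sum_(i < n) (sigma ^+ i.+1 * (l * g i) + sigma ^+ i.+1 * v i
  + if i == 0 :> nat then 0 else sigma ^+ i.+1 * g (ord_pred i)))).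
  apply: ler_sum => i _; apply: (le_trans (ler_wpM2l (exprn_ge0 _ s0) (gg' i))).
  by rewrite !mulrDr; case: ifP; rewrite ?mulr0.
rewrite 2!big_split/= (sum_ordS (fun i j => sigma ^+ i.+1 * g j)).
rewrite mulrDl [leRHS]addrAC lerD//.
  by rewrite mulr_sumr lerD2r ler_sum// => i _; rewrite mulrCA.
rewrite mulr_sumr ler_sum// => j _; case: ltnP => h.
  by rewrite /= modn_small// exprS mulrA.
by rewrite mulr_ge0// mulr_ge0// exprn_ge0.
Qed.

(** * Demand functions: slopes near equilibrium and a lower bound above it *)

Section Demand.
Context (R : realType) (a : R) (f : R -> R) (delta tdelta L : R).
Hypothesis fH : assumption_H a f delta tdelta L.

(** Mean value theorem: [[z, y]] lies inside [(0, tdelta)], where the derivative is between [1 - L]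
    and 1. *)
Lemma demand_slope z y : 0 < z -> z <= y -> y < tdelta ->
  (1 - L) * (y - z) <= f y - f z <= y - z.
Proof.
case: fH => -[_ _ _ _ _] [_ /andP[_ td] fd fL f1] z0 zy ytd.
have zyd t : t \in `[z, y] -> 0 < t < delta /\ t < tdelta.
  rewrite in_itv/= => /andP[zt ty].
  have ttd := le_lt_trans ty ytd.
  by rewrite (lt_le_trans z0 zt) (lt_le_trans ttd td).
have [||t tzy ->] := @MVT_segment _ f (f^`())%classic z y zy.
- move=> t /subset_itv_oo_cc/zyd[t0 _]; rewrite derive1E.
  have [fdt _] := fd t t0; exact: derivableP fdt.
- apply: derivable_within_continuous => t /zyd[t0 _].
  have [fdt _] := fd t t0; exact: fdt.
have [t0 t1] := zyd _ tzy.
have yz : 0 <= y - z by rewrite subr_ge0.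
rewrite ler_wpM2r//= ?ler_piMl ?f1// fL// t1 andbT.
by case/andP: t0.
Qed.

(** The demand first rises and then falls, so on [[x0, a]] it is smallest at an endpoint. *)
Lemma demand_ge_min x0 z : 0 < x0 < tdelta -> x0 <= z <= a ->
  Num.min (f x0) (f a) <= f z.
Proof.
case: fH => -[_ _ /andP[d0 da] finc fdec] [_ /andP[_ td] _ _ _].
move=> /andP[x00 x0td] /andP[x0z za]; rewrite ge_min.
have [zd|dz] := leP z delta.
  move: x0z; rewrite le_eqVlt => /predU1P[->|x0z]; first by rewrite lexx.
  rewrite ltW//; apply: finc; rewrite ?in_itv//=.
    by rewrite (ltW x00)/= (le_trans (ltW x0td)).
  by rewrite zd (ltW (lt_trans x00 x0z)).
rewrite orbC fdec// in_itv/=.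
  by rewrite da lexx.
by rewrite (ltW dz).
Qed.

Section NearEquilibrium.
Context (x0 x : R).
Hypotheses (x00 : 0 < x0 < tdelta) (x_gt0 : 0 < x) (xtd : x < tdelta).
Let e := x - x0.
Let df := f x - f x0.

(** The deviation [e] and the demand variation [df] have the same sign, with ratio between [1 - L]
    and 1; the four estimates below are read off by cases on this sign. *)
Let slope : (0 <= e /\ (1 - L) * e <= df <= e) \/
            (e <= 0 /\ (1 - L) * (- e) <= - df <= - e).
Proof.
rewrite /e /df; case/andP: x00 => x00' x0td; have [xx0|x0x] := leP x x0.
  by right; rewrite !opprB subr_le0; split=> //; apply: demand_slope.
by left; rewrite subr_ge0 (ltW x0x); split=> //; apply: demand_slope => //; exact: ltW.
Qed.

Let L01 : 0 < L < 1. Proof. by case: fH => _ []. Qed.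

Let residual y z : (1 - L) * y <= z -> y - z <= L * y.
Proof. by rewrite mulrBl mul1r lerBlDl lerBlDr. Qed.

Lemma demand_residual_norm : `|e - df| <= L * `|e|.
Proof.
case: slope => -[e0 /andP[h1 h2]].
  by rewrite (ger0_norm e0) ger0_norm ?subr_ge0// residual.
rewrite (ler0_norm e0) ler0_norm; first by rewrite (opprD e (- df)); exact: residual.
by rewrite subr_le0 -lerN2.
Qed.

Lemma demand_residual_pos : e - df <= L * Num.max 0 e.
Proof.
case: slope => -[e0 /andP[h1 h2]]; first by rewrite max_r// residual.
by rewrite max_l// mulr0 subr_le0 -lerN2.
Qed.

Lemma demand_variation_norm : `|df| <= `|e|.
Proof.
case/andP: L01 => _; rewrite -subr_gt0 => /ltW L1.
case: slope => -[e0 /andP[h1 h2]].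
  by rewrite (ger0_norm e0) ger0_norm// (le_trans _ h1)// mulr_ge0.
rewrite (ler0_norm e0) ler0_norm// -oppr_ge0 (le_trans _ h1)// mulr_ge0//.
by rewrite oppr_ge0.
Qed.

Lemma demand_variation_pos : df <= Num.max 0 e.
Proof.
case/andP: L01 => _; rewrite -subr_gt0 => /ltW L1.
case: slope => -[e0 /andP[h1 h2]]; first by rewrite max_r.
rewrite max_l// -oppr_ge0 (le_trans _ h1)// mulr_ge0//.
by rewrite oppr_ge0.
Qed.

End NearEquilibrium.

End Demand.

(** * Flows between cells, invariance of the state space and mass balance *)

Section FreewayFlow.
Context (R : realType) (n : nat) (fw : freeway R n).
Local Notation a := (capacity fw).
Local Notation q := (max_inflow fw).
Local Notation c := (congestion fw).
Local Notation p := (exit_rate fw).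
Local Notation f := (demand fw).

Definition inflow (x u : 'rV[R]_n) (i : 'I_n) : R :=
  Num.min (supply fw x i) (total_demand fw x u i).

Definition outflow (d : 'rV[R]_n.-1) (x u : 'rV[R]_n) (i : 'I_n) : R :=
  (if (i.+1 < n)%N then outflow_share fw d x u (ordS i) else 1) * f i (x 0 i).

Lemma freeway_mapE d x u i :
  freeway_map fw d x u 0 i = x 0 i - outflow d x u i + inflow x u i.
Proof. by rewrite mxE /inflow /supply minA. Qed.

Lemma disturbance_at_itv d (i : 'I_n) : @disturbance_set R n d ->
  0 <= disturbance_at d i <= 1.
Proof.
by move=> Dd; rewrite /disturbance_at; case: insubP => [j _ _|_]; rewrite ?lexx ?ler01.
Qed.

Lemma ord_predS (i : 'I_n) : i != 0 :> nat -> (ord_pred i).+1 = i.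
Proof.
by case: i => -[|k] kn//= _; rewrite modnDr modn_small// ltnW.
Qed.

(** A predecessor is never the last cell, whose exit rate is 1. *)
Lemma exit_rate_pred (i : 'I_n) : i != 0 :> nat -> 0 < 1 - p (ord_pred i) <= 1.
Proof.
move=> i0; have /andP[h0 h1] := @exit_rate_itv _ _ fw (ord_pred i)
  (eq_ind_r (fun k => (k < n)%N) (ltn_ord i) (ord_predS i0)).
by rewrite subr_gt0 h1 gerBl.
Qed.

Hypothesis f_itv : forall i (z : R), 0 < z <= a i -> 0 < f i z < z.

Lemma f_gt0 x i : state_space fw x -> 0 < f i (x 0 i).
Proof. by move=> Sx; have /andP[] := f_itv (Sx i). Qed.

Lemma supply_ge0 x i : state_space fw x -> 0 <= supply fw x i.
Proof.
move=> /(_ i)/andP[_ xa]; rewrite le_min ltW ?max_inflow_gt0//=.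
have /andP[c0 _] := congestion_itv fw i.
by rewrite mulr_ge0 ?subr_ge0// ltW.
Qed.

Lemma upstream_demand_gt0 x (i : 'I_n) : state_space fw x -> i != 0 :> nat ->
  0 < upstream_demand fw x i.
Proof.
by move=> Sx /exit_rate_pred/andP[w0 _]; rewrite mulr_gt0// f_gt0.
Qed.

Lemma ordS_neq0 (i : 'I_n) : (i.+1 < n)%N -> ordS i != 0 :> nat.
Proof. by move=> h; rewrite /= modn_small. Qed.

Section Flow.
Context (d : 'rV[R]_n.-1) (x u : 'rV[R]_n).
Hypotheses (Dd : disturbance_set d) (Sx : state_space fw x).
Hypothesis (u0 : forall i, 0 <= u 0 i).

Lemma outflow_share_itv (i : 'I_n) : i != 0 :> nat -> 0 <= outflow_share fw d x u i <= 1.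
Proof.
move=> i0; apply: share_itv => //; first exact: disturbance_at_itv.
- exact: supply_ge0.
- exact: upstream_demand_gt0.
Qed.

Lemma outflow_itv i : 0 <= outflow d x u i <= f i (x 0 i).
Proof.
rewrite /outflow; have f0 := f_gt0 i Sx; case: ltnP => h.
  have /andP[s0 s1] := outflow_share_itv (ordS_neq0 h).
  by rewrite mulr_ge0 ?(ltW f0)//= ler_piMl// ltW.
by rewrite mul1r lexx ltW.
Qed.

Lemma inflow_ge0 i : 0 <= inflow x u i.
Proof.
rewrite le_min supply_ge0//= /total_demand; case: ifP => //= /negbT i0.
by rewrite addr_ge0// ltW// upstream_demand_gt0.
Qed.

(** A cell loses at most [f i (x 0 i)], which is less than its content, and, since the congestion
    factor is at most 1, gains at most its free room. *)
Lemma state_space_freeway_map : state_space fw (freeway_map fw d x u).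
Proof.
move=> i; rewrite freeway_mapE.
have /andP[y0 y1] := outflow_itv i.
have /andP[f0 f1] := f_itv (Sx i).
have in0 := inflow_ge0 i.
have in1 : inflow x u i <= a i - x 0 i.
  have /andP[c0 c1] := congestion_itv fw i.
  rewrite ge_min /supply ge_min; apply/orP; left; apply/orP; right.
  by rewrite ler_piMl// subr_ge0; case/andP: (Sx i).
by apply/andP; split; lra.
Qed.

(** What enters the next cell beyond its external input has left cell [i], where part of the outflow
    may also exit the road. [share_ge] makes this independent of the disturbance. *)
Lemma inflow_ordS_le (i : 'I_n) : (i.+1 < n)%N ->
  inflow x u (ordS i) - u 0 (ordS i) <= outflow d x u i.
Proof.
move=> h; have i0 := ordS_neq0 h.
have f0 := f_gt0 i Sx.
have /andP[w0 w1] := exit_rate_pred i0.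
have /andP[s0 s1] := outflow_share_itv i0.
rewrite /inflow /total_demand (negPf i0).
have := share_ge (supply fw x (ordS i)) (disturbance_at_itv (ordS i) Dd)
  (u0 (ordS i)) (upstream_demand_gt0 Sx i0).
move=> /le_trans; apply.
rewrite /outflow h ler_wpM2l// /upstream_demand ordSK ler_piMl ?(ltW f0)//.
by rewrite ordSK in w1.
Qed.

(** Mass balance of cells 0 to [j]: by [inflow_ordS_le] the internal flows cancel up to exits,
    leaving the external inputs and the outflow of cell [j]. *)
Lemma partial_sum_freeway_map j :
  partial_sum (freeway_map fw d x u) j - partial_sum x j <=
  \sum_(i < n | (i <= j)%N) u 0 i - outflow d x u j.
Proof.
have -> : partial_sum (freeway_map fw d x u) j = partial_sum x j
   - \sum_(i < n | (i <= j)%N) outflow d x u i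
   + \sum_(i < n | (i <= j)%N) inflow x u i.
  rewrite /partial_sum (eq_bigr _ (fun i _ => freeway_mapE d x u i)).
  by rewrite big_split/= sumrB.
have inle : \sum_(i < n | (i <= j)%N) inflow x u i <=
    \sum_(i < n | (i <= j)%N) u 0 i + \sum_(i < n | (i < j)%N) outflow d x u i.
  apply: (@le_trans _ _ (\sum_(i < n | (i <= j)%N) (u 0 i +
      if i == 0 :> nat then 0 else outflow d x u (ord_pred i)))).
    apply: ler_sum => i _; case: ifPn => i0.
      by rewrite addr0 ge_min /total_demand i0 lexx orbT.
    rewrite -lerBlDl -{1 2}(ord_predK i) inflow_ordS_le//.
    by rewrite ord_predS.
  rewrite big_split/= lerD2l big_mkcond/=.
  (* The condition is put on the downstream cell [i]; for [i = ordS k] it becomes [k < j]. *)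
  pose F (i k : 'I_n) := if (i <= j)%N then outflow d x u k else 0.
  rewrite (eq_bigr (fun i : 'I_n => if i == 0 :> nat then 0 else F i (ord_pred i))).
    rewrite (sum_ordS F) [leRHS]big_mkcond/=; apply: ler_sum => k _.
    have /andP[y0 _] := outflow_itv k.
    rewrite /F; case: (ltnP k.+1 n) => h; first by rewrite /= modn_small.
    by case: ifP.
  by move=> i _; rewrite /F; do 2 case: ifP.
have -> : \sum_(i < n | (i <= j)%N) outflow d x u i =
    outflow d x u j + \sum_(i < n | (i < j)%N) outflow d x u i.
  rewrite (bigD1 j)//=; congr (_ + _); apply: eq_bigl => i.
  by rewrite ltn_neqAle andbC.
by lra.
Qed.

(** Summing the balances over [j] collects the outflow of every cell once. Hence this mass decreases
    as soon as a single cell discharges, wherever it lies. *)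
Lemma total_partial_sum_freeway_map :
  \sum_(j < n) partial_sum (freeway_map fw d x u) j <=
  \sum_(j < n) partial_sum x j + n%:R * (\sum_(i < n) u 0 i)
  - \sum_(i < n) outflow d x u i.
Proof.
rewrite -addrA -lerBlDl -sumrB.
apply: le_trans (ler_sum _ (fun j _ => partial_sum_freeway_map j)) _.
rewrite sumrB lerD2r mulr_natl -[X in _ *+ X]card_ord -sumr_const ler_sum// => j _.
by rewrite big_mkcond/= ler_sum// => i _; case: ifP.
Qed.

Hypothesis unblocked : forall i, total_demand fw x u i <= supply fw x i.

(** When supply covers demand everywhere, all shares equal 1 and the disturbance drops out. *)
Lemma freeway_map_unblocked i : freeway_map fw d x u 0 i =
  x 0 i - f i (x 0 i) + total_demand fw x u i.
Proof.
rewrite freeway_mapE /inflow min_r// /outflow; case: ltnP => h; last by rewrite mul1r.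
have i0 := ordS_neq0 h.
rewrite /outflow_share share_eq1 ?mul1r//.
- exact: disturbance_at_itv.
- exact: supply_ge0.
- exact: upstream_demand_gt0.
- by have := unblocked (ordS i); rewrite {1}/total_demand (negPf i0).
Qed.

End Flow.

End FreewayFlow.

(** * Behaviour relative to the equilibrium: guaranteed discharge, and free flow nearby *)

Section Equilibrium.
Context (R : realType) (n : nat) (fw : freeway R n) (delta tdelta L : 'I_n -> R).
Context (us xs : 'rV[R]_n).
Local Notation a := (capacity fw).
Local Notation p := (exit_rate fw).
Local Notation f := (demand fw).
Hypothesis fH : forall i, assumption_H (a i) (f i) (delta i) (tdelta i) (L i).
Hypothesis us_input : @input_set R n us.
Hypothesis xs_itv : forall i, 0 < xs 0 i < tdelta i.
Hypothesis xs_balance : forall i, f i (xs 0 i) = total_demand fw xs us i.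
Hypothesis xs_free : forall i, total_demand fw xs us i < supply fw xs i.

Let f_itv i (z : R) : 0 < z <= a i -> 0 < f i z < z.
Proof. by case: (fH i) => -[_ + _ _ _] _; apply. Qed.

Lemma equilibrium_state : state_space fw xs.
Proof.
move=> i; case: (fH i) => -[_ _ /andP[_ da] _ _] [_ /andP[_ td] _ _ _].
case/andP: (xs_itv i) => -> h; exact: le_trans (ltW h) (le_trans td da).
Qed.

Lemma equilibrium_input_ge0 i : 0 <= us 0 i.
Proof. by have := us_input i; case: ifP => // _ /ltW. Qed.

(** Supply is nonincreasing in the density and drops at rate at most the congestion factor, which is
    at most 1; so a one-sided bound on [x] suffices. *)
Lemma supply_variation (x : 'rV[R]_n) i r : 0 <= r -> x 0 i <= xs 0 i + r ->
  supply fw xs i - r <= supply fw x i.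
Proof.
move=> r0 xr; have /andP[c0 c1] := congestion_itv fw i.
have cr : congestion fw i * (x 0 i - xs 0 i) <= r.
  apply: (@le_trans _ _ (congestion fw i * r)); last exact: ler_piMl.
  by rewrite ler_wpM2l ?(ltW c0)// lerBlDl.
rewrite /supply le_min; apply/andP; split.
  by rewrite lerBlDr ge_min lerDl r0.
by rewrite lerBlDr ge_min; apply/orP; right; lra.
Qed.

(* Some cell is at or above its equilibrium density; the last such cell
   discharges, because the next one is below equilibrium. *)
Lemma outflow_lower_bound : exists2 c0, 0 < c0 & forall d (x u : 'rV[R]_n),
  disturbance_set d -> state_space fw x -> (forall i, 0 <= u 0 i <= us 0 i) ->
  (exists i, xs 0 i <= x 0 i) -> c0 <= \sum_i outflow fw d x u i.
Proof.
pose g1 i := Num.min (f i (xs 0 i)) (f i (a i)).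
have g1_gt0 i : 0 < g1 i.
  rewrite lt_min (f_gt0 f_itv _ equilibrium_state)/=.
  have ai : 0 < a i <= a i by rewrite capacity_gt0 lexx.
  by case/andP: (f_itv ai).
(* Least flow into cell [i], beyond the external input, when it is not above equilibrium and its
   predecessor is not below: either supply or upstream demand limits it. The value 1 at the first
   cell is a filler, as [g2] is only used at a successor. *)
pose g2 (i : 'I_n) := if i == 0 :> nat then 1 else
  Num.min (supply fw xs i - us 0 i) ((1 - p (ord_pred i)) * g1 (ord_pred i)).
have g2_gt0 i : 0 < g2 i.
  rewrite /g2; case: ifPn => // i0.
  have /andP[w0 _] := exit_rate_pred fw i0.
  rewrite lt_min (mulr_gt0 w0 (g1_gt0 _)) andbT.
  rewrite subr_gt0 (le_lt_trans _ (xs_free i))// /total_demand (negPf i0) lerDl.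
  by rewrite ltW// upstream_demand_gt0//; exact: equilibrium_state.
have [c1 c1_gt0 c1g] := finite_lower_bound g1_gt0.
have [c2 c2_gt0 c2g] := finite_lower_bound g2_gt0.
exists (Num.min c1 c2); first by rewrite lt_min c1_gt0.
move=> d x u Dd Sx u01 [i0 xi0].
have u0 i : 0 <= u 0 i by case/andP: (u01 i).
have fx i : xs 0 i <= x 0 i -> g1 i <= f i (x 0 i).
  move=> xsx; apply: (demand_ge_min (fH i) (xs_itv i)).
  by rewrite xsx; case/andP: (Sx i).
have [k xk kmax] := @arg_maxnP _ i0 (fun i => xs 0 i <= x 0 i) (fun i => i : nat) xi0.
rewrite (bigD1 k)//=.
apply: (@le_trans _ _ (outflow fw d x u k)); last first.
  rewrite lerDl sumr_ge0// => i _.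
  by have /andP[] := outflow_itv f_itv u Dd Sx i.
have [kn|kn] := ltnP k.+1 n; last first.
  rewrite /outflow ltnNge kn/= mul1r ge_min (le_trans (c1g k))//.
  exact: fx.
apply: le_trans (inflow_ordS_le f_itv Dd Sx u0 kn).
have k0 := ordS_neq0 kn.
have xk1 : x 0 (ordS k) <= xs 0 (ordS k) + 0.
  rewrite addr0 leNgt; apply/negP => /ltW/kmax.
  by rewrite /= modn_small// ltnn.
have sk := supply_variation (lexx 0) xk1.
rewrite subr0 in sk.
have /andP[_ uk] := u01 (ordS k).
have := c2g (ordS k).
rewrite /g2 (negPf k0) le_min => /andP[h1 h2].
rewrite ge_min; apply/orP; right.
rewrite lerBrDr /inflow /total_demand (negPf k0) le_min; apply/andP; split; first lra.
rewrite addrC lerD2l (le_trans h2)// /upstream_demand ordSK.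
have /andP[w0 _] := exit_rate_pred fw k0; rewrite ordSK in w0.
by rewrite ler_wpM2l ?fx// ltW.
Qed.

(** With all upward deviations at most [eps], supply falls and demand rises by at most [eps] each,
    so half the equilibrium slack absorbs both. Cells may be arbitrarily far below equilibrium. *)
Lemma free_flow_margin : exists2 eps, 0 < eps &
  (forall i, xs 0 i + eps < tdelta i) /\
  forall x u : 'rV[R]_n, state_space fw x -> (forall i, u 0 i <= us 0 i) ->
    (forall i, x 0 i <= xs 0 i + eps) ->
    forall i, total_demand fw x u i <= supply fw x i.
Proof.
pose g i := Num.min ((tdelta i - xs 0 i) / 2)
                    ((supply fw xs i - total_demand fw xs us i) / 2).
have g_gt0 i : 0 < g i.
  have /andP[_ h] := xs_itv i.
  by rewrite lt_min !divr_gt0// subr_gt0// xs_free.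
have [eps eps0 epsg] := finite_lower_bound g_gt0.
have epsi i : xs 0 i + eps < tdelta i.
  have := epsg i; have /andP[_ h] := xs_itv i.
  by rewrite le_min => /andP[h1 _]; lra.
exists eps => //; split=> // x u Sx uus xeps i.
have sx := supply_variation (ltW eps0) (xeps i).
have := epsg i; rewrite le_min => /andP[_ h].
suff : total_demand fw x u i <= total_demand fw xs us i + eps by lra.
have ui := uus i.
rewrite /total_demand; case: ifPn => i0; first by lra.
have /andP[w0 w1] := exit_rate_pred fw i0.
rewrite /upstream_demand; set j := ord_pred i in w0 w1 *.
rewrite -addrA lerD// -lerBlDl -mulrBr.
have /andP[xj _] := Sx j.
have fe := demand_variation_pos (fH j) (xs_itv j) xj (le_lt_trans (xeps j) (epsi j)).
have me : Num.max 0 (x 0 j - xs 0 j) <= eps.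
  by rewrite ge_max (ltW eps0)/= lerBlDl xeps.
apply: (@le_trans _ _ ((1 - p j) * eps)); last by apply: ler_piMl => //; exact: ltW.
by rewrite ler_wpM2l ?(ltW w0)// (le_trans fe).
Qed.

Section FreeFlowStep.
Context (d : 'rV[R]_n.-1) (x u : 'rV[R]_n).
Hypotheses (Dd : disturbance_set d) (Sx : state_space fw x).
Hypothesis (u01 : forall i, 0 <= u 0 i <= us 0 i).
Hypothesis (xtd : forall i, x 0 i < tdelta i).
Hypothesis (unblocked : forall i, total_demand fw x u i <= supply fw x i).

Lemma free_flow_deviation i : freeway_map fw d x u 0 i - xs 0 i =
  ((x 0 i - xs 0 i) - (f i (x 0 i) - f i (xs 0 i))) - (us 0 i - u 0 i)
  + (if i == 0 :> nat then 0 else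
     (1 - p (ord_pred i)) * (f (ord_pred i) (x 0 (ord_pred i))
                           - f (ord_pred i) (xs 0 (ord_pred i)))).
Proof.
have u0 j : 0 <= u 0 j by case/andP: (u01 j).
rewrite (freeway_map_unblocked f_itv Dd Sx u0 unblocked).
have := xs_balance i; rewrite /total_demand /upstream_demand.
by case: ifP => _ ->; lra.
Qed.

(** Reducing the input only lowers the positive part, so no perturbation appears; the summand 0
    matches the shape of [weighted_sum_shift]. *)
Lemma free_flow_pos l i : (forall i, L i <= l) ->
  Num.max 0 (freeway_map fw d x u 0 i - xs 0 i) <=
  l * Num.max 0 (x 0 i - xs 0 i) + 0
  + (if i == 0 :> nat then 0 else Num.max 0 (x 0 (ord_pred i) - xs 0 (ord_pred i))).
Proof.
move=> Ll; have mx0 j : 0 <= Num.max 0 (x 0 j - xs 0 j) by rewrite le_max lexx.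
have L0 : 0 < L i by case: (fH i) => _ [/andP[]].
have l0 : 0 <= l by rewrite (le_trans (ltW L0)).
rewrite addr0 ge_max; apply/andP; split.
  by rewrite addr_ge0 ?mulr_ge0//; case: ifP.
have /andP[ui0 ui] := u01 i.
rewrite free_flow_deviation lerD//.
  have /andP[xi _] := Sx i.
  have := demand_residual_pos (fH i) (xs_itv i) xi (xtd i).
  have := ler_wpM2r (mx0 i) (Ll i); lra.
case: ifPn => // i0; set j := ord_pred i.
have /andP[w0 w1] := exit_rate_pred fw i0.
have /andP[xj _] := Sx j.
have h := demand_variation_pos (fH j) (xs_itv j) xj (xtd j).
apply: (@le_trans _ _ ((1 - p j) * Num.max 0 (x 0 j - xs 0 j))).
  by rewrite ler_wpM2l// ltW.
exact: ler_piMl.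
Qed.

(** Below equilibrium a reduced input moves the state further away, hence the extra term
    [us 0 i - u 0 i]. *)
Lemma free_flow_norm l i : (forall i, L i <= l) ->
  `|freeway_map fw d x u 0 i - xs 0 i| <=
  l * `|x 0 i - xs 0 i| + (us 0 i - u 0 i)
  + (if i == 0 :> nat then 0 else `|x 0 (ord_pred i) - xs 0 (ord_pred i)|).
Proof.
move=> Ll; have /andP[ui0 ui] := u01 i.
rewrite free_flow_deviation (le_trans (ler_normD _ _))// lerD//.
  rewrite (le_trans (ler_normB _ _))// [X in _ + X]ger0_norm ?subr_ge0// lerD//.
  have /andP[xi _] := Sx i.
  have := demand_residual_norm (fH i) (xs_itv i) xi (xtd i).
  by move=> /le_trans; apply; rewrite ler_wpM2r.
case: ifPn => [_|i0]; first by rewrite normr0.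
set j := ord_pred i.
have /andP[w0 w1] := exit_rate_pred fw i0.
have /andP[xj _] := Sx j.
have h := demand_variation_norm (fH j) (xs_itv j) xj (xtd j).
by rewrite normrM (gtr0_norm w0) (le_trans _ h)// ler_piMl.
Qed.

Lemma free_flow_contraction l sigma : 0 <= sigma -> (forall i, L i <= l) ->
  let x' := freeway_map fw d x u in
  \sum_(i < n) sigma ^+ i.+1 * `|x' 0 i - xs 0 i| <=
    (l + sigma) * (\sum_(i < n) sigma ^+ i.+1 * `|x 0 i - xs 0 i|)
    + \sum_(i < n) sigma ^+ i.+1 * (us 0 i - u 0 i) /\
  Xi sigma xs x' <= (l + sigma) * Xi sigma xs x.
Proof.
move=> s0 Ll /=; split.
  by apply: weighted_sum_shift => // i; exact: free_flow_norm.
have sum0 : \sum_(i < n) sigma ^+ i.+1 * 0 = 0 :> R.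
  by rewrite big1// => i _; rewrite mulr0.
rewrite -[leRHS]addr0 -[X in _ <= _ + X]sum0.
apply: weighted_sum_shift => // i; last exact: free_flow_pos.
by rewrite le_max lexx.
Qed.

End FreeFlowStep.

End Equilibrium.

(** * Scalar form of the decrease: [N], [X], [W] stand for the weighted norm, [Xi] and the summed
    mass, primes for the next step *)

Section ScalarDecrease.
Context (R : realType) (B1 B2 h l G r Ws C tau Q theta A K lam : R).
Hypotheses (h0 : 0 < h) (l01 : 0 < l < 1) (r0 : 0 < r) (B20 : 0 < B2).
Hypotheses (C0 : 0 <= C) (theta0 : 0 < theta) (A0 : 0 < A) (K0 : 0 < K).
Hypotheses (QWs : Q = Ws + 1) (thetah : theta * h = Q).
Hypotheses (tauC : (C + theta) * tau <= 1) (GA : 2 * G <= A * (1 - l)).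
Hypothesis KB : 2 * ((1 + A) * B1) <= K * r.
Hypotheses (lam_l : (1 + l) / 2 <= lam) (lam_r : 1 - r / (2 * B2) <= lam).
Context (N X W N' X' W' : R).
Hypotheses (N0 : 0 <= N) (X0 : 0 <= X) (W0 : 0 < W <= B2).
Hypotheses (N'B : N' <= B1) (X'B : X' <= B1) (W'0 : 0 < W').
Hypothesis near : X < h -> N' <= l * N + G * X /\ X' <= l * X.
Hypothesis drain : tau <= X -> W' <= W - r.
Hypothesis tauh : tau <= h.
Hypothesis WX : W' <= Ws + C * X'.

Let lam0 : 0 <= lam.
Proof. by case/andP: l01 => l0 _; apply: le_trans lam_l; rewrite divr_ge0 ?addr_ge0 ?ltW. Qed.

(** On a range bounded by [B2], a constant drop [r / 2] is at least the proportional drop of factor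
    [1 - r / (2 * B2)]. *)
Let lam_excess y : 0 <= y <= B2 -> y - r / 2 <= lam * y.
Proof.
case/andP=> y0 yB; apply: le_trans (ler_wpM2r y0 lam_r).
rewrite mulrBl mul1r lerD2l lerN2.
rewrite (_ : r / (2 * B2) * y = r / 2 * (y / B2)); last by field; rewrite gt_eqF.
by rewrite ler_piMr ?divr_ge0 ?(ltW r0)// ler_pdivrMr// mul1r.
Qed.

Let excess (W X : R) := Num.max 0 (W - (Q - theta * Num.min h X)).

(** Since [X' <= X], the threshold does not fall. If [tau <= X], the drain lowers the excess by [r].
    Otherwise [W'] is at most [Ws + C * X'], and [tauC] keeps it below the threshold, whose margin
    over [Ws] is 1. *)
Let excess_near : X < h -> excess W' X' <= lam * excess W X.
Proof.
move=> Xh; have [_ X'X] := near Xh.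
have X'leX : X' <= X.
  by apply: (le_trans X'X); case/andP: l01 => _ l1; rewrite ler_piMl// ltW.
have e0 : 0 <= excess W X by rewrite /excess le_max lexx.
have le0 := mulr_ge0 lam0 e0.
rewrite {1}/excess ge_max le0/= min_r ?(ltW (le_lt_trans X'leX Xh))//.
have tX' := ler_wpM2l (ltW theta0) X'leX.
have [/drain Wr|Xtau] := leP tau X.
  have [e1|e1] := leP (W - (Q - theta * X)) 0.
    by apply: le_trans le0; move: Wr tX' e1 r0; lra.
  have eE : excess W X = W - (Q - theta * X).
    by rewrite /excess min_r ?(ltW Xh)// max_r// ltW.
  have tX : theta * X <= Q by rewrite -thetah ler_wpM2l// ltW.
  have : 0 <= W - (Q - theta * X) <= B2.
    by case/andP: W0 => _; move: tX e1; lra.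
  by move/lam_excess; rewrite eE; move: Wr tX' r0; lra.
apply: le_trans le0.
have X'tau : (C + theta) * X' <= (C + theta) * tau.
  by rewrite ler_wpM2l ?addr_ge0 ?(ltW theta0)// (le_trans X'leX)// ltW.
by move: X'tau WX tauC; rewrite QWs; lra.
Qed.

(** Here the threshold is 0 and the excess is [W] itself. Half of the drop [r] yields the factor
    [lam]; the other half, multiplied by [K], pays for [N' + A * X']. *)
Let excess_far : h <= X ->
  N' + A * X' + K * excess W' X' <= lam * (K * excess W X).
Proof.
move=> hX; have /andP[Wp WB] := W0.
have eE : excess W X = W.
  by rewrite /excess min_l// thetah subrr subr0 max_r// ltW.
have eE' : excess W' X' <= W - r.
  apply: le_trans (drain (le_trans tauh hX)).
  rewrite /excess ge_max (ltW W'0)/= gerBl subr_ge0 -thetah.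
  by rewrite ler_wpM2l ?(ltW theta0)// ge_min lexx.
have e1 := ler_wpM2l (ltW K0) eE'.
have e2 : W - r / 2 <= lam * W by rewrite lam_excess// (ltW Wp).
have e3 := ler_wpM2l (ltW K0) e2.
have e4 := ler_wpM2l (ltW A0) X'B.
rewrite eE mulrCA; apply: le_trans e3.
by move: e1 e4 KB N'B; lra.
Qed.

(** In the near case, weakening the rate from [l] to [(1 + l) / 2] frees [A * (1 - l) / 2 * X],
    which covers the perturbation [G * X]. *)
Lemma scalar_decrease : N' + A * X' + K * excess W' X' <=
  lam * (N + A * X + K * excess W X).
Proof.
have NX : 0 <= N + A * X by rewrite addr_ge0// mulr_ge0// ltW.
rewrite [leRHS]mulrDr.
have [hX|Xh] := leP h X.
  by rewrite (le_trans (excess_far hX))// lerDr mulr_ge0.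
have [h1 h2] := near Xh.
apply: lerD; last first.
  by rewrite mulrCA ler_wpM2l ?excess_near// ltW.
apply: le_trans (ler_wpM2r NX lam_l).
have h3 := ler_wpM2l (ltW A0) h2.
have h4 := ler_wpM2r X0 GA.
have h5 : l * N <= (1 + l) / 2 * N.
  by rewrite ler_wpM2r//; case/andP: l01; lra.
by move: h1 h3 h4 h5; lra.
Qed.

End ScalarDecrease.

(** * Estimates for [Xi] and the weighted norm *)

Section WeightedDeviation.
Context (R : realType) (n : nat) (sigma : R) (xs : 'rV[R]_n).
Hypothesis sigma01 : 0 < sigma <= 1.
Implicit Type x : 'rV[R]_n.

Let sigma_ge0 : 0 <= sigma. Proof. by case/andP: sigma01 => /ltW. Qed.

Let sigma_exp_itv (i : 'I_n) : sigma ^+ n <= sigma ^+ i.+1 <= 1.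
Proof.
case/andP: sigma01 => s0 s1.
by rewrite exprn_ile1// andbT ler_wiXn2l.
Qed.

Let weighted_sum_itv (g : 'I_n -> R) : (forall i, 0 <= g i) ->
  sigma ^+ n * (\sum_(i < n) g i) <= \sum_(i < n) sigma ^+ i.+1 * g i
    <= \sum_(i < n) g i.
Proof.
move=> g0; rewrite mulr_sumr; apply/andP; split; apply: ler_sum => i _.
  by rewrite ler_wpM2r//; case/andP: (sigma_exp_itv i).
by rewrite ler_piMl//; case/andP: (sigma_exp_itv i).
Qed.

Let pos_ge0 x i : 0 <= Num.max 0 (x 0 i - xs 0 i). Proof. by rewrite le_max lexx. Qed.

Lemma weighted_norm_itv x :
  sigma ^+ n * (\sum_i `|x 0 i - xs 0 i|)
    <= \sum_(i < n) sigma ^+ i.+1 * `|x 0 i - xs 0 i| <= \sum_i `|x 0 i - xs 0 i|.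
Proof. by apply: weighted_sum_itv => i. Qed.

Lemma Xi_ge0 x : 0 <= Xi sigma xs x.
Proof. by apply: sumr_ge0 => i _; rewrite mulr_ge0// exprn_ge0. Qed.

Lemma sum_pos_le_Xi x :
  sigma ^+ n * (\sum_i Num.max 0 (x 0 i - xs 0 i)) <= Xi sigma xs x.
Proof. by case/andP: (weighted_sum_itv (pos_ge0 x)). Qed.

Lemma Xi_le_norm x : Xi sigma xs x <= \sum_i `|x 0 i - xs 0 i|.
Proof.
case/andP: (weighted_sum_itv (pos_ge0 x)) => _ /le_trans; apply.
by apply: ler_sum => i _; rewrite ge_max normr_ge0 ler_norm.
Qed.

(** Every weight is at least [sigma ^+ n], so a small [Xi] bounds each upward deviation. *)
Lemma Xi_lt_pos_lt x eps i : Xi sigma xs x < sigma ^+ n * eps ->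
  x 0 i <= xs 0 i + eps.
Proof.
case/andP: sigma01 => s0 _; move/(le_lt_trans (sum_pos_le_Xi x)).
rewrite ltr_pM2l ?exprn_gt0// => h; rewrite -lerBlDl.
apply: le_trans (ltW h); rewrite (bigD1 i)//= -[leLHS]addr0 lerD ?sumr_ge0//.
by rewrite le_max lexx orbT.
Qed.

Lemma Xi_gt0_ex x : 0 < Xi sigma xs x -> exists i, xs 0 i <= x 0 i.
Proof.
move=> X0; apply: contrapT => /forallNP nx; move: X0.
rewrite /Xi big1 ?ltxx// => i _; rewrite max_l ?mulr0// subr_le0 leNgt.
by apply/negP => /ltW/nx.
Qed.

Lemma Xi_equilibrium : Xi sigma xs xs = 0.
Proof. by rewrite /Xi big1// => i _; rewrite subrr maxxx mulr0. Qed.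

Lemma total_partial_sum_le_pos x : \sum_(j < n) partial_sum x j <=
  \sum_(j < n) partial_sum xs j + n%:R * (\sum_i Num.max 0 (x 0 i - xs 0 i)).
Proof.
rewrite mulr_natl -[X in _ *+ X]card_ord -sumr_const -big_split/=.
apply: ler_sum => j _; rewrite -lerBlDl -sumrB big_mkcond/=.
by apply: ler_sum => i _; case: ifP; rewrite ?pos_ge0// le_max lexx orbT.
Qed.

Lemma total_partial_sum_le_Xi x : \sum_(j < n) partial_sum x j <=
  \sum_(j < n) partial_sum xs j + n%:R / sigma ^+ n * Xi sigma xs x.
Proof.
apply: le_trans (total_partial_sum_le_pos x) _; rewrite lerD2l -mulrA ler_wpM2l//.
by case/andP: sigma01 => s0 _; rewrite mulrC ler_pdivlMr ?exprn_gt0// mulrC sum_pos_le_Xi.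
Qed.

End WeightedDeviation.

(** * The feedback: range, distance to the nominal input, saturation *)

Section Feedback.
Context (R : realType) (n : nat) (sigma tau : R) (us xs : 'rV[R]_n) (b : 'I_n -> R).
Hypotheses (sigma01 : 0 < sigma <= 1) (tau0 : 0 < tau).
Hypothesis us0 : forall i, 0 <= us 0 i.
Let J := [set i | 0 < us 0 i]%SET.
Hypothesis b_itv : forall i, i \in J -> 0 < b i < us 0 i.
Let k := feedback sigma xs us J b tau.

Lemma feedback_itv x i : 0 <= k x 0 i <= us 0 i.
Proof.
rewrite mxE; case: ifP => [/b_itv/andP[b0 b1]|_]; last by rewrite lexx us0.
rewrite le_max (ltW b0) orbT/= ge_max (ltW b1) andbT gerBl.
by rewrite mulr_ge0 ?Xi_ge0// mulr_ge0 ?invr_ge0 ?subr_ge0 ?ltW.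
Qed.

Lemma feedback_gt0 x i : 0 < us 0 i -> 0 < k x 0 i.
Proof.
move=> ui; have iJ : i \in J by rewrite inE.
by rewrite mxE iJ lt_max; case/andP: (b_itv iJ) => ->; rewrite orbT.
Qed.

(** The gain is at most [us 0 i / tau] because [b i] is positive, and the maximum with [b i] only
    raises the input. *)
Lemma feedback_deviation x i :
  us 0 i - k x 0 i <= us 0 i / tau * Xi sigma xs x.
Proof.
have X0 := Xi_ge0 xs sigma01 x.
rewrite mxE; case: ifP => [/b_itv/andP[b0 b1]|_]; last first.
  by rewrite subrr mulr_ge0// divr_ge0// ltW.
rewrite lerBlDl -lerBlDr le_max; apply/orP; left.
rewrite lerD2l lerN2 ler_wpM2r// mulrC ler_wpM2r ?invr_ge0 ?(ltW tau0)//.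
by rewrite gerBl ltW.
Qed.

(** Once [Xi] reaches [tau], the linear part has fallen to [b i] or lower; an index outside [J] has
    no positive nominal input. *)
Lemma feedback_saturated x beta i : 0 <= beta -> (i \in J -> b i <= beta) ->
  tau <= Xi sigma xs x -> k x 0 i <= beta.
Proof.
move=> beta0 bbeta tX; rewrite mxE; case: ifPn => [iJ|]; last first.
  by rewrite inE -leNgt => /le_trans; apply.
case/andP: (b_itv iJ) => b0 b1.
rewrite ge_max (bbeta iJ) andbT; apply: le_trans (bbeta iJ).
rewrite lerBlDl -lerBlDr mulrAC ler_peMl ?subr_ge0 ?(ltW b1)//.
by rewrite mulrC ler_pdivlMr// mul1r.
Qed.

Lemma feedback_equilibrium : k xs = us.
Proof.
apply/rowP => i; rewrite mxE; case: ifP => // /b_itv/andP[_ b1].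
by rewrite /= Xi_equilibrium mulr0 subr0 max_l// ltW.
Qed.

End Feedback.

(** * Bounds from the capacities *)

Section StateBounds.
Context (R : realType) (n : nat) (fw : freeway R n) (x xs : 'rV[R]_n).
Hypotheses (Sx : state_space fw x) (Sxs : state_space fw xs).

Lemma sum_deviation_le_capacity :
  \sum_i `|x 0 i - xs 0 i| <= \sum_i capacity fw i.
Proof.
apply: ler_sum => i _; have /andP[x0 xa] := Sx i; have /andP[y0 ya] := Sxs i.
by rewrite ler_norml; apply/andP; split; lra.
Qed.

Lemma total_partial_sum_itv : (0 < n)%N ->
  0 < \sum_(j < n) partial_sum x j <= n%:R * \sum_i capacity fw i.
Proof.
move=> n0; have x0 i : 0 <= x 0 i by have /andP[/ltW] := Sx i.
have ps0 j : 0 <= partial_sum x j by exact: sumr_ge0.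
apply/andP; split.
  rewrite (bigD1 (Ordinal n0))//= ltr_pwDl ?sumr_ge0//.
  rewrite /partial_sum (bigD1 (Ordinal n0))//= ltr_pwDl ?sumr_ge0//.
  by have /andP[] := Sx (Ordinal n0).
rewrite mulr_natl -[X in _ *+ X]card_ord -sumr_const ler_sum// => j _.
rewrite /partial_sum big_mkcond/= ler_sum// => i _.
case: ifP => _; first by have /andP[] := Sx i.
exact/ltW/capacity_gt0.
Qed.

End StateBounds.

(** * Choice of the constants and conclusion *)

Unset Implicit Arguments.
Set Strict Implicit.

Theorem theorem2p1 (R : realType) (n : nat) (hn : (3 <= n)%N)
    (fw : freeway R n) (delta tdelta L : 'I_n -> R)
    (hH : forall i, assumption_H (capacity fw i) (demand fw i)
                      (delta i) (tdelta i) (L i))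
    (us xs : 'rV[R]_n)
    (hus : @input_set R n us)
    (hxs : forall i, 0 < xs 0 i < tdelta i)
    (heq : forall i, demand fw i (xs 0 i) = total_demand fw xs us i)
    (hlt : forall i, total_demand fw xs us i < supply fw xs i) :
  exists (J : {set 'I_n}) (sigma : R) (b : 'I_n -> R) (taus : R),
    [/\ forall i, i \in J -> 0 < us 0 i,
        0 < sigma <= 1,
        forall i, i \in J -> 0 < b i < us 0 i,
        0 < taus
      & forall tau, 0 < tau < taus ->
        let k := feedback sigma xs us J b tau in
        let S := state_space fw in
        let D := @disturbance_set R n in
        let closed_loop := fun d x => freeway_map fw d x (k x) in
        [/\ forall x, S x -> @input_set R n (k x),
            RGES S D closed_loop xs
          & exists Q h theta A K : R,
              [/\ 0 < Q, 0 < h, 0 < theta, 0 < A & 0 < K] /\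
              lyapunov_with_exponent S D closed_loop xs 1
                (lyapunov_candidate sigma xs Q h theta A K)]].
Proof.
have n0 : (0 < n)%N by rewrite (leq_trans _ hn).
have nR0 : 0 < n%:R :> R by rewrite ltr0n.
have nR1 : 1 <= n%:R :> R by rewrite ler1n.
have f_itv i (z : R) : 0 < z <= capacity fw i -> 0 < demand fw i z < z.
  by case: (hH i) => -[_ + _ _ _] _; apply.
have Sxs := equilibrium_state hH hxs.
have us0 := equilibrium_input_ge0 hus.
have L01 i : 0 < L i < 1 by case: (hH i) => _ [].
have [e e0 eL] : exists2 e, 0 < e & forall i, e <= 1 - L i.
  by apply: finite_lower_bound => i; rewrite subr_gt0; case/andP: (L01 i).
have [eps eps0 [epstd unblocked]] := free_flow_margin hH hxs hlt.
have [c0 c00 drain] := outflow_lower_bound hH hxs hlt.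
have e1 : e < 1.
  by have := eL (Ordinal n0); case/andP: (L01 (Ordinal n0)); lra.
(* All [L i] are at most [1 - e]; adding the coupling cost [sigma] gives exactly [l]. *)
pose sigma := e / 2; pose l := 1 - e / 2.
have sigma01 : 0 < sigma <= 1 by rewrite /sigma; apply/andP; split; lra.
have l01 : 0 < l < 1 by rewrite /l; apply/andP; split; lra.
have sn0 : 0 < sigma ^+ n by rewrite exprn_gt0//; case/andP: sigma01.
have sigma_ge0 : 0 <= sigma by case/andP: sigma01 => /ltW.
pose J := [set i | 0 < us 0 i]%SET.
(* If every input is at most [beta], then [n] times their sum is at most [c0 / 2], half of the
   guaranteed outflow. *)
pose beta := c0 / (2 * n%:R ^+ 2).
have beta0 : 0 < beta by rewrite divr_gt0// mulr_gt0// exprn_gt0.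
pose b i := Num.min (us 0 i / 2) beta.
have b_itv i : i \in J -> 0 < b i < us 0 i.
  rewrite inE => ui; rewrite lt_min beta0 divr_gt0//= gt_min.
  by apply/orP; left; lra.
(* Below this level of [Xi], [Xi_lt_pos_lt] puts the state within the free-flow margin [eps]. *)
pose h := sigma ^+ n * eps.
have h0 : 0 < h by rewrite mulr_gt0.
pose Ws := \sum_(j < n) partial_sum xs j.
have Ws0 : 0 < Ws by case/andP: (total_partial_sum_itv Sxs n0).
(* [Q] exceeds the equilibrium mass by 1, and [theta] makes the threshold vanish exactly when [Xi]
   reaches [h]. *)
pose Q := Ws + 1; have Q0 : 0 < Q by rewrite addr_gt0.
pose theta := Q / h; have theta0 : 0 < theta by rewrite divr_gt0.
pose C := n%:R / sigma ^+ n; have C0 : 0 < C by rewrite divr_gt0.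
(* The first bound makes the feedback saturated throughout the region where [Xi] is at least [h];
   the second gives [tauC]. *)
pose taus := Num.min h (C + theta)^-1.
exists J, sigma, b, taus; split => //.
- by move=> i; rewrite inE.
- by rewrite lt_min h0 invr_gt0 addr_gt0.
move=> tau /andP[tau0]; rewrite lt_min => /andP[/ltW tauh tauC] k S D F.
have {}tauC : (C + theta) * tau <= 1.
  by rewrite mulrC -ler_pdivlMr ?addr_gt0// mul1r ltW.
have k01 x i : 0 <= k x 0 i <= us 0 i by exact: feedback_itv.
have k0 x i : 0 <= k x 0 i by case/andP: (k01 x i).
have FS d x : D d -> S x -> S (F d x).
  by move=> Dd Sx; exact: state_space_freeway_map.
have xtd (x : 'rV[R]_n) : (forall i, x 0 i <= xs 0 i + eps) -> forall i, x 0 i < tdelta i.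
  by move=> xe i; exact: le_lt_trans (xe i) (epstd i).
have near d x : D d -> S x -> Xi sigma xs x < h ->
  \sum_(i < n) sigma ^+ i.+1 * `|F d x 0 i - xs 0 i| <=
    l * (\sum_(i < n) sigma ^+ i.+1 * `|x 0 i - xs 0 i|)
    + (\sum_i us 0 i / tau) * Xi sigma xs x /\
  Xi sigma xs (F d x) <= l * Xi sigma xs x.
  move=> Dd Sx Xh.
  have xe i := Xi_lt_pos_lt sigma01 i Xh.
  have kus i : k x 0 i <= us 0 i by case/andP: (k01 x i).
  have Ll i : L i <= 1 - e by have := eL i; lra.
  have lE : 1 - e + sigma = l by rewrite /sigma /l; lra.
  have [h1 h2] := free_flow_contraction hH hxs heq Dd Sx (k01 x) (xtd _ xe)
    (unblocked x (k x) Sx kus xe) sigma_ge0 Ll.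
  rewrite -lE; split => //; apply: (le_trans h1); rewrite lerD2l mulr_suml.
  apply: ler_sum => i _; apply: (@le_trans _ _ (us 0 i - k x 0 i)).
    by rewrite ler_piMl ?subr_ge0// exprn_ile1//; case/andP: sigma01.
  exact: feedback_deviation.
have re : robust_equilibrium S D F xs.
  split=> // d Dd; apply/rowP => i.
  have kus : k xs = us by exact: feedback_equilibrium.
  have xe j : xs 0 j <= xs 0 j + eps by rewrite lerDl ltW.
  rewrite /F kus (freeway_map_unblocked f_itv Dd Sxs us0).
    by rewrite -heq subrK.
  by move=> j; apply: unblocked.
pose G := \sum_i us 0 i / tau.
have G0 : 0 <= G by apply: sumr_ge0 => i _; rewrite divr_ge0// ltW.
have l1 : 0 < 1 - l by rewrite subr_gt0; case/andP: l01.
(* [G] grows like [1 / tau], so [A] and [K] are chosen after [tau], unlike [Q], [h] and [theta]. *)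
pose A := 2 * (G + 1) / (1 - l).
have A0 : 0 < A by rewrite divr_gt0// mulr_gt0// ltr_wpDl.
pose r := c0 / 2; have r0 : 0 < r by rewrite divr_gt0.
pose B1 := \sum_i capacity fw i.
pose B2 := n%:R * B1.
have B10 : 0 < B1.
  rewrite /B1 (bigD1 (Ordinal n0))//= ltr_pwDl ?capacity_gt0// sumr_ge0// => i _.
  exact/ltW/capacity_gt0.
have B20 : 0 < B2 by rewrite mulr_gt0.
pose K := 2 * ((1 + A) * B1) / r.
have K0 : 0 < K by rewrite divr_gt0// mulr_gt0// mulr_gt0// addr_gt0.
have NB (x : 'rV[R]_n) : S x -> \sum_(i < n) sigma ^+ i.+1 * `|x 0 i - xs 0 i| <= B1.
  move=> Sx; case/andP: (weighted_norm_itv xs sigma01 x) => _ /le_trans; apply.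
  exact: sum_deviation_le_capacity.
have XB x : S x -> Xi sigma xs x <= B1.
  move=> Sx; apply: le_trans (Xi_le_norm xs sigma01 x) _.
  exact: sum_deviation_le_capacity.
have N0 (x : 'rV[R]_n) : 0 <= \sum_(i < n) sigma ^+ i.+1 * `|x 0 i - xs 0 i|.
  by apply: sumr_ge0 => i _; rewrite mulr_ge0// exprn_ge0.
have drainW d x : D d -> S x -> tau <= Xi sigma xs x ->
  \sum_(j < n) partial_sum (F d x) j <= \sum_(j < n) partial_sum x j - r.
  move=> Dd Sx tX; apply: le_trans (total_partial_sum_freeway_map f_itv Dd Sx (k0 x)) _.
  have := drain d x (k x) Dd Sx (k01 x) (Xi_gt0_ex (lt_le_trans tau0 tX)).
  suff : n%:R * (\sum_i k x 0 i) <= r by rewrite /r; lra.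
  have : \sum_i k x 0 i <= \sum_(i < n) beta.
    apply: ler_sum => i _; apply: (feedback_saturated tau0 b_itv _ _ tX); first exact: ltW.
    by move=> _; rewrite /b ge_min lexx orbT.
  move/(ler_wpM2l (ltW nR0))/le_trans; apply.
  rewrite sumr_const card_ord -mulr_natl /beta /r le_eqVlt; apply/orP; left.
  by apply/eqP; field; rewrite gt_eqF.
pose V := lyapunov_candidate sigma xs Q h theta A K.
suff lyap : lyapunov_with_exponent S D F xs 1 V.
  split.
  - move=> x Sx i; case: ifPn => i0; last exact: k0.
    by apply: feedback_gt0 => //; have := hus i; rewrite i0.
  - exact: lyapunov_RGES lyap.
  - by exists Q, h, theta, A, K.
pose E (x : 'rV[R]_n) := \sum_(i < n) `|x 0 i - xs 0 i|.
have excess0 (x : 'rV[R]_n) : 0 <= K * Num.max 0 (\sum_(j < n) partial_sum x j -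
    (Q - theta * Num.min h (Xi sigma xs x))).
  by rewrite mulr_ge0 ?(ltW K0)// le_max lexx.
have NV (x : 'rV[R]_n) : \sum_(i < n) sigma ^+ i.+1 * `|x 0 i - xs 0 i| <= V x.
  rewrite /V /lyapunov_candidate -addrA lerDl addr_ge0// mulr_ge0 ?Xi_ge0//.
  exact: ltW.
split=> //.
  by move=> x Sx; exact: le_trans (N0 x) (NV x).
(* Linear upper bound on [V]: at equilibrium the mass is 1 below the threshold, so the excess is at
   most the variation of mass and threshold, that is [n%:R + theta] times the deviation. *)
pose M := 1 + A + K * (n%:R + theta).
have M1 : 1 <= M by rewrite /M -addrA lerDl addr_ge0 ?(ltW A0)// mulr_ge0 ?addr_ge0 ?ltW.
have snle : sigma ^+ n <= 1.
  by rewrite exprn_ile1//; case/andP: sigma01.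
(* The decay factor is the worse of the free-flow rate and the drain rate. *)
exists (sigma ^+ n), (M * n%:R), (Num.max ((1 + l) / 2) (1 - r / (2 * B2))).
split => //.
- by rewrite (le_trans snle)// mulr_ege1.
- have rB : 0 < r / (2 * B2) by rewrite divr_gt0// mulr_gt0.
  case/andP: l01 => l0 l1'; apply/andP; split.
    by rewrite le_max divr_ge0// addr_ge0// ltW.
  by rewrite gt_max ltr_pdivrMr// mul1r ltrD2l l1' gtrBl.
- move=> x Sx; rewrite powRr1 ?euclid_norm_ge0//.
  have EE : E x = \sum_i `|(x - xs) 0 i| by apply: eq_bigr => i _; rewrite !mxE.
  have E1 : euclid_norm (x - xs) <= E x by rewrite EE; exact: euclid_norm_le_sum.
  have E2 : E x <= n%:R * euclid_norm (x - xs).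
    by rewrite EE; exact: sum_norm_le_euclid_norm.
  have /andP[N1 N2] := weighted_norm_itv xs sigma01 x.
  have X1 := Xi_le_norm xs sigma01 x.
  apply/andP; split.
    apply: le_trans (NV x); apply: le_trans N1.
    by rewrite ler_wpM2l// ltW.
  rewrite -mulrA; apply: (@le_trans _ _ (M * E x)); last first.
    by rewrite ler_wpM2l// (le_trans _ M1).
  rewrite /V /lyapunov_candidate /M mulrDl lerD//.
    by rewrite mulrDl mul1r lerD// ler_wpM2l// ltW.
  rewrite -mulrA ler_wpM2l ?(ltW K0)// ge_max.
  have E0 : 0 <= E x by exact: sumr_ge0.
  rewrite mulr_ge0 ?addr_ge0 ?(ltW theta0) ?(ltW nR0)//=.
  have W1 : \sum_(j < n) partial_sum x j <= Ws + n%:R * E x.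
    apply: le_trans (total_partial_sum_le_pos xs x) _.
    rewrite lerD2l ler_wpM2l ?(ltW nR0)//; apply: ler_sum => i _.
    by rewrite ge_max normr_ge0 ler_norm.
  have t1 : theta * Num.min h (Xi sigma xs x) <= theta * E x.
    by rewrite ler_wpM2l ?(ltW theta0)// ge_min X1 orbT.
  by rewrite mulrDl lerBlDr /Q; move: W1 t1; clear; lra.
- move=> d x Dd Sx; have SF := FS d x Dd Sx.
  have [] := (total_partial_sum_itv Sx n0, total_partial_sum_itv SF n0).
  move=> Wx /andP[W'0 _].
  apply: (@scalar_decrease _ B1 B2 h l G r Ws C tau) => //.
  + exact: ltW.
  + by rewrite /theta divfK// gt_eqF.
  + by rewrite /A divfK ?gt_eqF//; lra.
  + by rewrite /K divfK// gt_eqF.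
  + by rewrite le_max lexx.
  + by rewrite le_max lexx orbT.
  + exact: Xi_ge0.
  + exact: NB.
  + exact: XB.
  + exact: near.
  + exact: drainW.
  + exact: total_partial_sum_le_Xi.
Qed.
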